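(* Define, for any $\alpha \in (0,1)$ and $b, \varepsilon > 0$, $$\omega_\alpha(b,\varepsilon):=\frac{1-\alpha}{4b\alpha} \cdot \varepsilon^2.$$ Let $X$ be a Hilbert space, $\alpha \in(0,1)$ and $R: X\to X$ an $\alpha$-averaged mapping. Then $R$ is strongly nonexpansive with modulus $\omega_\alpha$.
   Context: Let $X$ be a Hilbert space. A mapping $T: X \to X$ is nonexpansive if $\|Tx-Ty\| \leq \|x-y\|$ for all $x,y \in X$. For $\alpha \in (0,1)$, a mapping $R:X \to X$ is $\alpha$-averaged if there is a nonexpansive $T:X \to X$ such that $Rx = (1-\alpha)x+\alpha Tx$ for all $x \in X$. Given $\omega:(0,\infty) \times (0,\infty) \to (0,\infty)$, a mapping $T:X\to X$ is called strongly nonexpansive with modulus $\omega$ if for any $b, \varepsilon > 0$ and $x, y \in X$ with $\|x-y\| \leq b$ and $\|x-y\| - \|Tx-Ty\| < \omega(b,\varepsilon)$, we have $\|(x-y) - (Tx-Ty)\| < \varepsilon$. *)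

(* Defs.v *)
From HB Require Import structures.
From mathcomp Require Import all_boot all_order all_algebra.
From mathcomp Require Import all_classical all_reals all_analysis.

Set Implicit Arguments.
Unset Strict Implicit.
Unset Printing Implicit Defensive.

Import Order.TTheory GRing.Theory Num.Theory.
Import numFieldNormedType.Exports.

Local Open Scope ring_scope.

(* Real Hilbert spaces: the inner product is a symmetric positive definite
   bilinear form inducing the norm of a complete normed module. *)
HB.mixin Record CompleteNormedModule_isHilbert (R : realType) X
    & CompleteNormedModule R X := {
  inner : {dot X for @idfun R};
  normr_inner : forall x : X, `|x| ^+ 2 = inner x x
}.

#[short(type="hilbertType")]
HB.structure Definition Hilbert (R : realType) :=
  {X of CompleteNormedModule R X & CompleteNormedModule_isHilbert R X}.

Definition nonexpansive (R : realType) (X : hilbertType R) (T : X -> X) : Prop :=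
  forall x y : X, `|T x - T y| <= `|x - y|.

Definition averaged (R : realType) (X : hilbertType R) (alpha : R)
    (f : X -> X) : Prop :=
  exists2 T : X -> X, nonexpansive T &
    forall x : X, f x = (1 - alpha) *: x + alpha *: T x.

(* A modulus is a map (0, oo) x (0, oo) -> (0, oo); it is represented by a
   function on R x R of which only the values at positive arguments matter,
   and the first conjunct says that those values are positive. *)
Definition strongly_nonexpansive_with (R : realType) (X : hilbertType R)
    (omega : R -> R -> R) (T : X -> X) : Prop :=
  (forall b eps : R, 0 < b -> 0 < eps -> 0 < omega b eps) /\
  (forall (b eps : R) (x y : X), 0 < b -> 0 < eps ->
     `|x - y| <= b ->
     `|x - y| - `|T x - T y| < omega b eps ->
     `|(x - y) - (T x - T y)| < eps).

Definition omega_averaged (R : realType) (alpha b eps : R) : R :=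
  (1 - alpha) / (4 * b * alpha) * eps ^+ 2.

(* Main.v *)
(** Put u = x - y, v = Tx - Ty and w = fx - fy. Then u - w = alpha (u - v) and
    w = u - alpha (u - v), so expanding squares and using |v| <= |u| gives
      (1 - alpha) |u - w|^2 <= alpha (|u|^2 - |w|^2)
                             = alpha (|u| - |w|) (|u| + |w|).
    The last factor is at most 2 |u| <= 2 b, which even yields the constant
    1/2 instead of 1/4 in the modulus. *)
Require Import Defs.
From mathcomp Require Import all_boot all_order all_algebra.
From mathcomp Require Import all_classical all_reals all_analysis.
From mathcomp Require Import ring lra.
Import Order.TTheory GRing.Theory Num.Theory.
Import numFieldNormedType.Exports.

Local Open Scope ring_scope.

Lemma normrB_sqr (R : realType) (X : hilbertType R) (x y : X) :
  `|x - y| ^+ 2 = `|x| ^+ 2 - 2 * inner x y + `|y| ^+ 2.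
Proof.
rewrite !normr_inner linearBl /= !linearBr /=.
(* A dot product is a Hermitian form with sign [(-1) ^+ 0] and identity conjugation, hence
   symmetric. *)
have -> : inner y x = inner x y by rewrite hermC expr0 mul1r.
ring.
Qed.

Lemma averagedB (R : realType) (X : hilbertType R) (alpha : R) (f T : X -> X)
    (fE : forall x, f x = (1 - alpha) *: x + alpha *: T x) (x y : X) :
  f x - f y = (x - y) - alpha *: ((x - y) - (T x - T y)).
Proof.
rewrite !fE opprD addrACA -!scalerBr scalerBl scale1r.
by rewrite [in RHS]scalerBr opprB addrA addrAC.
Qed.

Lemma averaged_norm_sqr (R : realType) (X : hilbertType R) (alpha : R)
    (alpha_gt0 : 0 < alpha) (f : X -> X) (f_averaged : averaged alpha f)
    (x y : X) :
  (1 - alpha) * `|(x - y) - (f x - f y)| ^+ 2 <=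
  alpha * (`|x - y| ^+ 2 - `|f x - f y| ^+ 2).
Proof.
case: f_averaged => T T_nonexp fE; rewrite (averagedB _ _ _ _ _ fE).
set u := x - y; set d := u - (T x - T y).
(* Since [u - d] is [T x - T y], this is nonexpansiveness squared and expanded. *)
have d_le : `|d| ^+ 2 <= 2 * inner u d.
  have : `|u - d| ^+ 2 <= `|u| ^+ 2.
    by rewrite ler_sqr ?nnegrE // /d subKr T_nonexp.
  by rewrite normrB_sqr; lra.
have innerZ : inner u (alpha *: d) = alpha * inner u d.
  by rewrite linearZr_LR.
rewrite subKr normrB_sqr innerZ normrZ (gtr0_norm alpha_gt0).
(* This is exactly the right side of the goal minus its left side. *)
have : 0 <= alpha ^+ 2 * (2 * inner u d - `|d| ^+ 2).
  by rewrite mulr_ge0 ?sqr_ge0 // subr_ge0.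
lra.
Qed.

Theorem proposition2p7 (R : realType) (X : hilbertType R) (alpha : R)
    (alpha_gt0 : 0 < alpha) (alpha_lt1 : alpha < 1)
    (f : X -> X) (f_averaged : averaged alpha f) :
  strongly_nonexpansive_with (omega_averaged alpha) f.
Proof.
have alphaC_gt0 : 0 < 1 - alpha by rewrite subr_gt0.
split=> [b eps b_gt0 eps_gt0|b eps x y b_gt0 eps_gt0 u_le gap_lt].
  by rewrite /omega_averaged mulr_gt0 ?exprn_gt0 ?divr_gt0 ?mulr_gt0.
have := averaged_norm_sqr _ _ _ alpha_gt0 _ f_averaged x y.
move: u_le gap_lt.
set p := `|x - y|; set q := `|f x - f y|; set r := `|_ - (f x - f y)|.
move=> p_le gap_lt r_le.
have [p_ge0 q_ge0] : 0 <= p /\ 0 <= q by split; exact: normr_ge0.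
have r2_ge0 : 0 <= (1 - alpha) * r ^+ 2 by rewrite mulr_ge0 ?sqr_ge0 // ltW.
(* The left side of [r_le] is nonnegative, which forces [q ^+ 2 <= p ^+ 2]. *)
have q_le : q <= p.
  rewrite -ler_sqr ?nnegrE // -subr_ge0 -(pmulr_rge0 _ alpha_gt0).
  exact: le_trans r2_ge0 r_le.
have omegaE : alpha * (2 * b * omega_averaged alpha b eps)
    = (1 - alpha) * eps ^+ 2 / 2.
  by rewrite /omega_averaged; field; rewrite !gt_eqF.
(* Here [p + q <= 2 * p <= 2 * b], and [q_le] allows multiplying by [p - q]. *)
have gap_sqr : p ^+ 2 - q ^+ 2 <= 2 * b * (p - q).
  by rewrite subr_sqr mulrC ler_wpM2r ?subr_ge0 //; lra.
have eps2_gt0 : 0 < (1 - alpha) * eps ^+ 2 by rewrite mulr_gt0 ?exprn_gt0.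
have gap_omega : alpha * (p ^+ 2 - q ^+ 2) < (1 - alpha) * eps ^+ 2 / 2.
  rewrite -omegaE ltr_pM2l //; apply: le_lt_trans gap_sqr _.
  by rewrite ltr_pM2l ?mulr_gt0.
(* After squaring and scaling by [1 - alpha], [r_le] and [gap_omega] bound the left side by half of
   the right side, which is positive. *)
rewrite -ltr_sqr ?nnegrE ?normr_ge0 ?(ltW eps_gt0) // -(ltr_pM2l alphaC_gt0).
lra.
Qed.
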